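(* Let $G$ be a finite abelian group of order $n$. If $S$ is a sequence over $G$ with $|S|\ge n$, then \[ MZ(S)\le n-|\operatorname{supp}(S)|+1. \]
   Context: Groups are written additively. A sequence $S$ over a finite abelian group $G$ is a finite multiset of elements of $G$ (order irrelevant, repetition allowed); a subsequence is a submultiset of occurrences. $|S|$ denotes the length of $S$ (number of terms counted with multiplicity), and $\operatorname{supp}(S)$ denotes the set of distinct elements of $G$ occurring in $S$. A subsequence is zero-sum if the sum of its terms (with multiplicity) is $0$. $MZ(S)$ is the smallest positive integer $r$ such that $S$ has a zero-sum subsequence of length $r$; if $S$ has no nonempty zero-sum subsequence, $MZ(S)=\infty$. *)

(* Defs.v *)
From mathcomp Require Import all_boot all_order all_algebra.
From mathcomp Require Import finmap multiset.
From mathcomp Require Import boolp constructive_ereal.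

Set Implicit Arguments.
Unset Strict Implicit.
Unset Printing Implicit Defensive.

Import GRing.Theory.
Local Open Scope mset_scope.
Local Open Scope ring_scope.

Definition supp (G : finZmodType) (S : {mset G}) : {fset G} := finsupp S.

Definition zero_sum (G : finZmodType) (S : {mset G}) : Prop :=
  \sum_(x <- S) x = 0.

Definition has_zero_sum_subseq (G : finZmodType) (S : {mset G}) (r : nat) :
    Prop :=
  exists T : {mset G}, [/\ T `<=` S, size T = r & zero_sum T].

(* Extended integers, so that the empty minimum has the value +oo; the value
   -oo is never taken. *)
Definition MZ (G : finZmodType) (S : {mset G}) : \bar int :=
  match pselect (exists r, `[< (0 < r)%N /\ has_zero_sum_subseq S r >]) with
  | left ex_r => (ex_minn ex_r)%:Z%:E
  | right _ => +oo%E
  end.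

(* Main.v *)
(** Split [S] into one copy of each element of its support and a rest, and let
    [A] be the set of sums of subsequences that use at most one term of the
    support part.  At first [A] is [0] together with the support.  Feeding in a
    further term [g] of the rest replaces [A] by [A + {0, g}]; if [A] does not
    grow then [g + A = A], so [-g] lies in [A] and a short zero-sum subsequence
    appears.  Otherwise [n - |supp S|] terms of the rest would give [n + 1]
    elements of [G]. *)
Require Import Defs.
From mathcomp Require Import all_boot all_order all_algebra.
From mathcomp Require Import finmap multiset constructive_ereal.
From mathcomp Require Import boolp.
Import Order.TTheory GRing.Theory Num.Theory.
Local Open Scope mset_scope.
Local Open Scope ring_scope.

Lemma card_setU_shift (G : finZmodType) (A : {set G}) (g : G) :
  0 \in A -> - g \notin A -> (#|A| < #|A :|: [set (g + x)%R | x in A]|)%N.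
Proof.
move=> A0 NgA; rewrite ltnNge; apply/negP => leA.
have /eqP defA : A == A :|: [set (g + x)%R | x in A].
  by rewrite eqEcard subsetUl leA.
have sgA : [set (g + x)%R | x in A] \subset A by rewrite {2}defA subsetUr.
(* Translation by [g] is injective, so [g + A] has as many elements as [A] and the inclusion is an
   equality; then [0 \in A] is some [g + x]. *)
have /eqP eqgA : [set (g + x)%R | x in A] == A.
  by rewrite eqEcard sgA card_imset ?leqnn //; exact: addrI.
move: A0; rewrite -eqgA => /imsetP[x Ax /esym/eqP].
by rewrite addrC addr_eq0 => /eqP xg; rewrite xg in Ax; rewrite Ax in NgA.
Qed.

(** Induction on [l]. The bound [(size l).+1] allows for all of [l] and one term of [K]. *)
Lemma zero_sum_or_many_subsums (G : finZmodType) (K l : seq G) :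
  uniq K ->
  (exists2 u, subseq u (l ++ K) &
     (0 < size u <= (size l).+1)%N /\ \sum_(x <- u) x = 0)
  \/ (exists A : {set G}, [/\ (size K + size l < #|A|)%N, 0 \in A &
        forall x, x \in A -> exists2 u, subseq u (l ++ K) &
          (size u <= (size l).+1)%N /\ \sum_(y <- u) y = x]).
Proof.
move=> uK; elim: l => [|g l [[u su [/andP[u0 ul] sum0]]|[A [ltA A0 subA]]]].
(* A term 0 is a zero-sum subsequence of length 1. If there is none, the empty sum 0 is a new
   element beside [K], which gives the strict inequality. *)
- have [K0|K0] := boolP (0 \in K).
    by left; exists [:: 0]; rewrite ?sub1seq // big_seq1.
  right; exists (0 |: [set x in K]); split.
  + rewrite addn0 cardsU1 inE K0 add1n ltnS cardsE; exact/eq_leq/esym/card_uniqP.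
  + exact: setU11.
  + move=> x; rewrite !inE => /orP[/eqP->|Kx].
      by exists [::]; rewrite ?sub0seq // big_nil.
    by exists [:: x]; rewrite ?sub1seq // big_seq1.
- left; exists u; first exact: subseq_trans su (subseq_cons _ _).
  by rewrite u0 (leq_trans ul) /=.
have subg x : x \in A -> exists2 u, subseq (g :: u) ((g :: l) ++ K) &
    (size u <= (size l).+1)%N /\ \sum_(y <- g :: u) y = g + x.
  move=> /subA[u su [ul <-]].
  by exists u; rewrite /= ?eqxx // big_cons.
(* If [- g] is the sum of [u], then [g :: u] sums to 0; otherwise [A] gains at least one element. *)
have [NgA|NgA] := boolP (- g \in A).
  have [u su [ul sumu]] := subg _ NgA.
  by left; exists (g :: u); rewrite // sumu subrr.
right; exists (A :|: [set (g + x)%R | x in A]); split.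
- by rewrite addnS; apply: leq_ltn_trans ltA (card_setU_shift _ _ _ A0 NgA).
- by rewrite inE A0.
move=> x /setUP[/subA[u su [ul <-]]|/imsetP[y /subg[u su [ul sumu]] ->]].
  exists u; first exact: subseq_trans su (subseq_cons _ _).
  by rewrite (leq_trans ul) /=.
by exists (g :: u).
Qed.

Lemma subseq_seq_mset (T : choiceType) (s t : seq T) :
  subseq s t -> seq_mset s `<=` seq_mset t.
Proof.
move=> st; apply/msubsetP => x; rewrite !mset_seqE.
exact: leq_count_subseq.
Qed.

Lemma has_short_zero_sum_subseq (G : finZmodType) (S : {mset G}) :
  (#|G| <= size S)%N ->
  exists2 r, (0 < r <= (#|G| - #|` supp S|).+1)%N & has_zero_sum_subseq S r.
Proof.
move=> leS; set K : seq G := supp S.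
have uK : uniq K by exact: fset_uniq.
have KS : seq_mset K `<=` S.
  apply/msubsetP => x; rewrite mset_seqE count_uniq_mem ?fset_uniq //.
  by rewrite msuppE in_mset; case: (S x).
have szK : (size K <= #|G|)%N by rewrite -(card_uniqP uK) max_card.
have permS : perm_eq ((S `\` seq_mset K) ++ K) S.
  apply/eq_seq_msetP; rewrite seq_mset_id; apply/msetP => x.
  rewrite mset_seqE count_cat count_mem_mset msetE2 mset_seqE subnK //.
  by have /msubsetP/(_ x) := KS; rewrite mset_seqE.
(* The rest has this many terms because [S] has at least [#|G|]. The length is chosen so that
   [size K + size l] is exactly [#|G|], which no subset of [G] exceeds. *)
set l := take (#|G| - size K) (S `\` seq_mset K).
have szl : size l = (#|G| - size K)%N.
  rewrite size_takel // leq_subLR addnC -size_cat.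
  by rewrite (perm_size permS).
have lKS : seq_mset (l ++ K) `<=` S.
  rewrite -[X in _ `<=` X]seq_mset_id -(elimT (eq_seq_msetP _ _) permS).
  by apply/subseq_seq_mset/cat_subseq => //; apply: take_subseq.
have [[u su [ur sumu]]|[A [ltA _ _]]] := zero_sum_or_many_subsums G K l uK.
  exists (size u); first by rewrite -szl.
  exists (seq_mset u); split.
  - exact: msubset_trans (subseq_seq_mset _ _ _ su) lKS.
  - exact: perm_size (perm_eq_seq_mset u).
  - by rewrite /zero_sum (perm_big _ (perm_eq_seq_mset u)).
by move: ltA; rewrite szl subnKC // ltnNge max_card.
Qed.

Theorem corollary3p2 (G : finZmodType) (n : nat) (S : {mset G}) :
  #|G| = n -> (n <= size S)%N ->
  (MZ S <= (n%:Z - #|` supp S|%:Z + 1)%:E)%E.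
Proof.
move=> <- /has_short_zero_sum_subseq[r /andP[r0 ler] zr].
have rP : `[< (0 < r)%N /\ has_zero_sum_subseq S r >] by apply/asboolP.
(* With this bound the truncated subtraction on [nat] agrees with the one on [int]. *)
have szK : (#|` supp S| <= #|G|)%N.
  rewrite -(card_uniqP (fset_uniq (supp S))); exact: max_card.
(* The length [r] rules out the value [+oo]. *)
rewrite /MZ; case: pselect => [ex_r|[]]; last by exists r.
case: ex_minnP => m _ /(_ _ rP) lemr.
rewrite lee_fin subzn // -PoszD addn1 lez_nat.
exact: leq_trans lemr ler.
Qed.
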